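(* Suppose $0<p<0.5$. Let $E(p)$ denote the expected shortfall $\mathrm{ES}_p(Z)$ of a standard normal random variable $Z$ at confidence level $p$. Then a Markowitz market with risk free asset admits an $\mathrm{ES}_p$-arbitrage if and only if either $$g\ge E(p)$$ or $$1+R_F<0,$$ where $g$ is the gradient of the capital allocation line and $R_F$ is the risk free return.
   Context: For a random variable $X$ with cumulative distribution function $F_X$, $\mathrm{VaR}_q(X)=-\inf\{x\in\mathbb R: F_X(x)>q\}$ and expected shortfall at confidence level $p$ is $\mathrm{ES}_p(X)=\frac1p\int_0^p \mathrm{VaR}_q(X)\,dq$. A market consists of a probability space $(\Omega,\mathcal F,\mathbb P)$ and a pricing function $\mathcal P:L^0(\Omega,\mathbb R)\to\mathbb R\cup\{+\infty\}$. An $\mathrm{ES}_p$-arbitrage is a random variable $X$ with $\mathcal P(X)\le 0$, $\mathrm{ES}_p(X)\le 0$ and $\mathbb P(X>0)>0$. Markowitz market with risk free asset: there are $N$ assets $X_1,\dots,X_N$ whose payoffs follow a multivariate normal distribution with mean vector $\boldsymbol\mu$ and (possibly singular) covariance matrix $\boldsymbol\Sigma$. A portfolio $\boldsymbol\alpha\in\mathbb R^N$ consists of $\alpha_j$ units of asset $j$; its payoff is $\sum_j\alpha_jX_j$, with mean $\boldsymbol\mu^\top\boldsymbol\alpha$ and variance $\boldsymbol\alpha^\top\boldsymbol\Sigma\boldsymbol\alpha$, and its cost is $\boldsymbol c^\top\boldsymbol\alpha$ for a fixed vector $\boldsymbol c$. Thus $\mathcal P(X)=\boldsymbol c^\top\boldsymbol\alpha$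 when $X=\sum_{j=1}^N\alpha_jX_j$, and $\mathcal P(X)=\infty$ if $X$ is not of this form. It is assumed that, up to scale, there is only one risk-free portfolio, i.e. $\ker\boldsymbol\Sigma$ is one-dimensional. Risk free return and capital allocation line (standard meaning): the risk-free portfolio can be normalised to $\boldsymbol\alpha^F\in\ker\boldsymbol\Sigma$ with $\boldsymbol c^\top\boldsymbol\alpha^F=1$, and then $1+R_F=\boldsymbol\mu^\top\boldsymbol\alpha^F$. With at least one risky asset ($N\ge2$), the gradient of the capital allocation line is $$g=\sup\left\{\frac{\boldsymbol\mu^\top\boldsymbol\alpha-(1+R_F)}{\sqrt{\boldsymbol\alpha^\top\boldsymbol\Sigma\boldsymbol\alpha}}\ :\ \boldsymbol c^\top\boldsymbol\alpha=1,\ \boldsymbol\alpha^\top\boldsymbol\Sigma\boldsymbol\alpha>0\right\}\ge 0,$$ so that the efficient unit-cost portfolios with standard deviation $\sigma$ have expected payoff $1+R_F+g\sigma$. *)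

(* Defs.v *)
From HB Require Import structures.
From mathcomp Require Import all_boot all_order all_algebra.
From mathcomp Require Import all_classical all_reals all_analysis.

Set Implicit Arguments.
Unset Strict Implicit.
Unset Printing Implicit Defensive.

Import Order.TTheory GRing.Theory Num.Theory.
Import numFieldNormedType.Exports.

Local Open Scope classical_set_scope.
Local Open Scope ring_scope.

Section risk_measures.
Context d (T : measurableType d) (R : realType) (P : probability T R).

(* Both notions take values in the extended reals: VaR_0 may be +oo, and so may
   ES_p for a heavy-tailed X. For 0 < p < 1 the integrand is bounded below, so
   the integral is always meaningful. *)
Definition VaR (q : R) (X : {RV P >-> R}) : \bar R :=
  (- ereal_inf [set x%:E | x in [set x : R | q%:E < cdf X x]])%E.

Definition ES (p : R) (X : {RV P >-> R}) : \bar R :=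
  ((p^-1)%:E * \int[lebesgue_measure]_(q in `[0%R, p]) VaR q X)%E.

(* A market is the probability space together with a pricing function. *)
Definition ES_arbitrage (price : {RV P >-> R} -> \bar R) (p : R)
    (X : {RV P >-> R}) : Prop :=
  [/\ (price X <= 0)%E, (ES p X <= 0)%E & (0 < P [set w | (0 < X w)%R])%E].

Definition admits_ES_arbitrage (price : {RV P >-> R} -> \bar R) (p : R) : Prop :=
  exists X : {RV P >-> R}, ES_arbitrage price p X.

End risk_measures.

Section normal.
Context d (T : measurableType d) (R : realType) (P : probability T R).

(* The library's [normal_prob m 0] is a uniform law, so the degenerate case has
   to be the Dirac mass explicitly. *)
Definition has_normal_law (Y : {RV P >-> R}) (m s : R) : Prop :=
  forall A : set R, measurable A ->
    distribution P Y A = if s == 0 then \d_m A else normal_prob m s A.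

Definition standard_normal (Z : {RV P >-> R}) : Prop := has_normal_law Z 0 1.

Definition payoff (N : nat) (X : 'I_N -> {RV P >-> R}) (a : 'cV[R]_N) :
    {RV P >-> R} :=
  \sum_(j < N) a j 0 *: (X j : {mfun T >-> R}).

(* Jointly normal in the sense allowing singular covariance: every linear
   combination is normal, possibly degenerate. *)
Definition multivariate_normal (N : nat) (X : 'I_N -> {RV P >-> R})
    (mu : 'cV[R]_N) (Sigma : 'M[R]_N) : Prop :=
  [/\ forall a : 'cV[R]_N, exists m s : R,
        0 <= s /\ has_normal_law (payoff X a) m s,
      forall j, ('E_P[X j] = (mu j 0)%:E)%E
    & forall i j, covariance P (X i) (X j) = (Sigma i j)%:E].

End normal.

Section markowitz.
Context (R : realType) (N : nat).
Implicit Types (a c mu : 'cV[R]_N) (Sigma : 'M[R]_N).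

Definition dot (u v : 'cV[R]_N) : R := (u^T *m v) 0 0.

Definition portfolio_variance Sigma a : R := (a^T *m Sigma *m a) 0 0.

(* [rf] is the risk-free return R_F *)
Definition capital_allocation_gradient c mu Sigma (rf : R) : \bar R :=
  ereal_sup [set ((dot mu a - (1 + rf)) / Num.sqrt (portfolio_variance Sigma a))%:E
            | a in [set a | dot c a = 1 /\ 0 < portfolio_variance Sigma a]].

Context d (T : measurableType d) (P : probability T R).
Variable X : 'I_N -> {RV P >-> R}.

(* Random variables are identified when almost surely equal. The infimum only
   matters if one payoff has portfolios of several costs (this can happen only
   for 1 + R_F = 0); otherwise see [markowitz_priceE]. *)
Definition markowitz_price c (Y : {RV P >-> R}) : \bar R :=
  ereal_inf [set (dot c a)%:E
            | a in [set a | {ae P, forall w, Y w = payoff X a w}]].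

Lemma payoffE a w : payoff X a w = \sum_(j < N) a j 0 * X j w.
Proof.
rewrite /payoff.
apply: (big_ind2 (fun (u : {mfun T >-> R}) v => u w = v)) => //.
by move=> u1 v1 u2 v2 <- <-.
Qed.

Lemma markowitz_priceE c (Y : {RV P >-> R}) a :
  {ae P, forall w, Y w = payoff X a w} ->
  (forall b, {ae P, forall w, Y w = payoff X b w} -> dot c b = dot c a) ->
  markowitz_price c Y = (dot c a)%:E.
Proof.
move=> Ya wd; rewrite /markowitz_price.
rewrite (_ : image _ _ = [set (dot c a)%:E]) ?ereal_inf1//.
apply/seteqP; split => [_ [b Yb <-]|_ ->] /=; first by rewrite (wd b).
by exists a.
Qed.

Lemma markowitz_price_unattainable c (Y : {RV P >-> R}) :
  (forall a, ~ {ae P, forall w, Y w = payoff X a w}) ->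
  markowitz_price c Y = +oo%E.
Proof.
move=> noY; rewrite /markowitz_price (_ : image _ _ = set0) ?ereal_inf0//.
by rewrite -subset0 => y -[b Yb _]; exact: (noY b).
Qed.

End markowitz.

(* Main.v *)
Require Import Defs.
From HB Require Import structures.
From mathcomp Require Import all_boot all_order all_algebra.
From mathcomp Require Import all_classical all_reals all_analysis.
From mathcomp Require Import measurable_realfun.
From mathcomp Require Import ring lra.

(** For a normal payoff of mean [m] and standard deviation [s] the value at risk,
    hence the expected shortfall, is affine in the standard normal one:
    [ES_p = - m + s E(p)], with [0 < E(p)] since the [p]-quantile of a standard
    normal law is negative for [p < 1/2].

    The excess return [e = mu - (1 + R_F) c] annihilates [aF], so it vanishes on
    the kernel of [Sigma] and [e = Sigma b] for some [b]. By Cauchy-Schwarz for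
    the covariance, [g <= sqrt (b^T Sigma b)]. If [E(p) <= g], then the zero-cost
    portfolio [b - (c^T b) aF], with mean [b^T Sigma b], is an arbitrage; if
    [1 + R_F < 0], then [- aF] is one. Conversely, let [Y] be an arbitrage and
    [0 <= 1 + R_F]. All portfolios with payoff [Y] share its mean and variance,
    and some of them cost less than any given [eps > 0]. If the variance is
    positive, completing such a portfolio with [aF] to unit cost shows
    [E(p) - O(eps) <= g]; if it is zero, [e] vanishes on the portfolio, so that
    its mean [(1 + R_F) c^T a] cannot be positive for all of them. *)

Import Order.TTheory GRing.Theory Num.Theory.
Import numFieldNormedType.Exports.
Local Open Scope classical_set_scope.
Local Open Scope ring_scope.
Set Implicit Arguments.
Unset Strict Implicit.
Unset Printing Implicit Defensive.

(** * Affine change of variable for normal laws *)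

Section normal_law.
Context {R : realType}.
Notation leb := (@lebesgue_measure R).
Notation nprob m s := (normal_prob m s : probability (measurableTypeR R) R).

(** The Radon-Nikodym derivative of the normal law and [normal_pdf m s] have the same integral over
    every measurable set, hence agree almost everywhere. *)
Lemma ge0_integral_normal_prob (m s : R) (f : R -> \bar R) :
  measurable_fun [set: R] f -> (forall x, (0 <= f x)%E) ->
  (\int[nprob m s]_x f x = \int[leb]_x (f x * (normal_pdf m s x)%:E))%E.
Proof.
move=> mf f0.
have dom := normal_prob_dominates m s.
rewrite -(Radon_Nikodym_SigmaFinite.change_of_variables dom)//.
apply: ae_eq_integral => //.
- apply: emeasurable_funM => //.
  by apply: (measurable_int leb); exact: Radon_Nikodym_SigmaFinite.f_integrable.
- apply: emeasurable_funM => //; apply/measurable_EFinP.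
  exact: measurable_normal_pdf.
apply: ae_eqe_mul2l => /=.
apply: integral_ae_eq => //=.
- exact: Radon_Nikodym_SigmaFinite.f_integrable.
- by apply/measurable_EFinP; exact: measurable_normal_pdf.
by move=> E _ mE; rewrite -Radon_Nikodym_SigmaFinite.f_integral.
Qed.

Definition standardize (m s : R) (x : R^o) : R^o := (x - m) / s.

Lemma derive1_standardize m s : (standardize m s)^`()%classic = cst s^-1.
Proof.
apply/funext => x; rewrite /standardize derive1E deriveM// deriveD// derive_cst scaler0.
by rewrite add0r derive_id derive_cst addr0 scaler1.
Qed.

Lemma normal_pdf_std m s x : 0 < s ->
  normal_pdf m s x = normal_pdf 0 1 (standardize m s x) * s^-1.
Proof.
move=> s0; have s_neq0 : s != 0 by rewrite gt_eqF.
rewrite !normal_pdfE ?oner_eq0//= mulrAC; congr (_ * expR _).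
  rewrite /normal_peak expr1n mul1r -mulrnAr sqrtrM ?sqr_ge0//.
  by rewrite sqrtr_sqr gtr0_norm// invfM mulrC.
by rewrite /standardize subr0 expr1n -[s ^+ 2 *+ 2]mulr_natr; field.
Qed.

Lemma derivable_standardize m s x : derivable (standardize m s) x 1.
Proof. by apply: derivableM => //; apply: derivableB. Qed.

Lemma continuous_standardize m s : continuous (standardize m s).
Proof.
by move=> x; exact/differentiable_continuous/derivable1_diffP/derivable_standardize.
Qed.

Lemma standardize_lt m s : 0 < s -> {homo standardize m s : x y / x < y}.
Proof. by move=> s0 x y xy; rewrite /standardize ltr_pM2r ?invr_gt0// ltrD2r. Qed.

Lemma standardize_Ny m s : 0 < s -> standardize m s x @[x --> -oo] --> -oo.
Proof.
move=> s0; apply/gt0_cvgMlNy; first by rewrite invr_gt0.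
exact: cvg_addrr_Ny.
Qed.

Lemma standardize_y m s : 0 < s -> standardize m s x @[x --> +oo] --> +oo.
Proof.
move=> s0; apply/gt0_cvgMly; first by rewrite invr_gt0.
exact: cvg_addrr.
Qed.

(** Substitution of [standardize m s] in the right-hand integral; its derivative [s^-1] is the
    factor appearing in [normal_pdf_std]. *)
Lemma integral_normal_std (m s : R) (f : R -> R) : 0 < s ->
  continuous f -> (forall x, 0 <= f x) ->
  (\int[nprob m s]_x (f x)%:E =
   \int[leb]_x (f (m + s * x) * normal_pdf 0 1 x)%:E)%E.
Proof.
move=> s0 cf f0; rewrite ge0_integral_normal_prob; first last.
- by move=> x; rewrite lee_fin.
- by apply/measurable_EFinP; exact: continuous_measurable_fun.
rewrite (@increasing_ge0_integration_by_substitutionT R (standardize m s)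
   (fun x => f (m + s * x) * normal_pdf 0 1 x)); first last.
- by move=> x; rewrite mulr_ge0 ?normal_pdf_ge0.
- move=> x; apply: continuousM; last first.
    by apply: continuous_normal_pdf; rewrite oner_eq0.
  apply: continuous_comp; last exact: cf.
  by apply: continuousD; [exact: cvg_cst|apply: continuousM => //; exact: cvg_cst].
- exact: standardize_y.
- exact: standardize_Ny.
- exact: derivable_standardize.
- by rewrite derive1_standardize; exact: is_cvg_cst.
- by rewrite derive1_standardize; exact: is_cvg_cst.
- by rewrite derive1_standardize => ?; exact: cvg_cst.
- exact: standardize_lt.
apply: eq_integral => x _; rewrite derive1_standardize !fctE -EFinM normal_pdf_std//.
rewrite mulrA; congr (f _ * _ * _)%:E.
by rewrite /standardize mulrC divfK ?gt_eqF// addrC subrK.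
Qed.

Lemma normal_prob_Nyc_std (m s x : R) : 0 < s ->
  normal_prob m s `]-oo, x] = normal_prob 0 1 `]-oo, (x - m) / s].
Proof.
move=> s0; rewrite /normal_prob (_ : (x - m) / s = standardize m s x)//.
rewrite (@increasing_ge0_integration_by_substitutionNy R (standardize m s)
   (normal_pdf 0 1) x); first last.
- by move=> y _; exact: normal_pdf_ge0.
- by apply/continuous_subspaceT/continuous_normal_pdf; rewrite oner_eq0.
- exact: standardize_Ny.
- split; first by move=> y _; exact: derivable_standardize.
  by apply: cvg_at_left_filter; exact: continuous_standardize.
- by rewrite derive1_standardize; exact: cvg_cst.
- by rewrite derive1_standardize; exact: is_cvg_cst.
- by rewrite derive1_standardize => ? _; exact: cvg_cst.
- by move=> y z _ _; exact: standardize_lt.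
by apply: eq_integral => y _; rewrite derive1_standardize !fctE normal_pdf_std.
Qed.

End normal_law.

(** * Moments of the standard normal law *)

Section standard_normal_moments.
Context {R : realType}.
Notation leb := (@lebesgue_measure R).
Notation phi := (normal_pdf (0 : R) 1).

Definition Phi (x : R) : R := (\int[leb]_(t in `]-oo, x]) phi t)%R.

Lemma continuous_phi : continuous phi.
Proof. by apply: continuous_normal_pdf; rewrite oner_eq0. Qed.

Lemma phiN x : phi (- x) = phi x.
Proof.
by rewrite normal_pdfE ?oner_eq0//= /normal_fun !subr0 sqrrN.
Qed.

Lemma PhiE x : normal_prob 0 1 `]-oo, x] = (Phi x)%:E.
Proof.
rewrite /Phi /Rintegral fineK//; apply: integrable_fin_num => //.
by apply: integrableS (integrable_normal_pdf 0 1).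
Qed.

Lemma is_derive_Phi x : is_derive x (1 : R) Phi (phi x).
Proof.
have [||||] := @continuous_FTC1 R phi -oo%O x (x + 1).
- by rewrite ltrDl.
- by apply: integrableS (integrable_normal_pdf 0 1).
- by rewrite ltNyr.
- exact: continuous_phi.
by move=> dF <-; rewrite derive1E; exact: DeriveDef.
Qed.

(** Since [phi] is even, its total mass 1 is twice the mass of the positive half-line, which
    reflection carries to []-oo, 0]]. *)
Lemma Phi0 : Phi 0 = 2^-1.
Proof.
have I : (\int[leb]_x (phi x)%:E = 1)%E by exact: integral_normal_pdf.
have mphi A : measurable_fun A (EFin \o phi).
  by apply/measurable_EFinP/measurable_funTS; exact: measurable_normal_pdf.
rewrite ge0_symfun_integralT in I; last 3 first.
- by move=> x; exact: normal_pdf_ge0.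
- exact: continuous_phi.
- by move=> x /=; rewrite phiN.
rewrite -set_itvcy ge0_integration_by_substitution0 in I; last 2 first.
- exact: mphi.
- by move=> x; rewrite lee_fin normal_pdf_ge0.
move: I; under eq_integral do rewrite phiN.
have := PhiE 0; rewrite /normal_prob => ->.
by rewrite -EFinM => -[] ?; lra.
Qed.

Let idTR : measurableTypeR R -> R := fun x => x.

#[local] HB.instance Definition _ := @isMeasurableFun.Build _ _ _ _ idTR
  (@measurable_id _ _ setT).

(** [Phi] is the cdf of the identity [idTR] under the standard normal law, so the limit common to
    all cdfs applies. *)
Lemma cvg_Phi_y : Phi x @[x --> +oo] --> (1 : R).
Proof.
have cdfE : cdf (P := normal_prob 0 1 : probability (measurableTypeR R) R) idTR
    = EFin \o Phi.
  by apply/funext => x; exact: PhiE.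
have := @cvg_cdfy1 _ _ R (normal_prob 0 1 : probability (measurableTypeR R) R) idTR.
by rewrite cdfE => /fine_cvg.
Qed.

Lemma is_derive_phi x : is_derive x (1 : R) phi (- x * phi x).
Proof.
rewrite normal_pdfE ?oner_eq0//= /normal_fun.
have d : is_derive x (1 : R) (fun x : R => - (x - 0) ^+ 2 / (1 ^+ 2 *+ 2)) (- x).
  by apply: is_derive_eq; rewrite /GRing.scale/= expr1n; field.
have d' : is_derive x (1 : R)
    (fun x : R => expR (- (x - 0) ^+ 2 / (1 ^+ 2 *+ 2)))
    (expR (- (x - 0) ^+ 2 / (1 ^+ 2 *+ 2)) * - x).
  exact: (is_derive1_comp _ d).
apply: is_derive_eq.
by rewrite /GRing.scale/=; ring.
Qed.

(** From [1 + y <= expR y] at [y = x ^+ 2 / 2], the Gaussian factor is at most [2 / x ^+ 2]; this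
    leaves a bound [k / x]. *)
Lemma cvg_id_phi_y : x * phi x @[x --> +oo] --> (0 : R).
Proof.
pose k := 2 * @normal_peak R 1.
have kx : k * x^-1 @[x --> +oo] --> (0 : R).
  rewrite -(mulr0 k); apply: cvgM; first exact: cvg_cst.
  by apply/gtr0_cvgV0; [near=> x|exact: cvg_id].
apply: (@squeeze_cvgr _ _ _ _ (cst 0) (fun x => k * x^-1)) => //; last exact: cvg_cst.
near=> x.
have x0 : 0 < x by near: x; exact: nbhs_pinfty_gt.
rewrite mulr_ge0 ?normal_pdf_ge0 ?(ltW x0)//=.
rewrite normal_pdfE ?oner_eq0//= /k /normal_fun subr0 expr1n mulNr expRN.
rewrite mulrCA [leRHS]mulrAC mulrC ler_wpM2r ?normal_peak_ge0//.
rewrite ler_pdivrMr ?expR_gt0// mulrAC ler_pdivlMr// -expr2.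
rewrite -ler_pdivrMl// mulrC; apply: le_trans (expR_ge1Dx _).
by rewrite lerDr.
Unshelve. all: by end_near. Qed.

(* [Phi x - x * phi x] is an antiderivative of [x ^+ 2 * phi x]. *)
Lemma second_moment_phi : (\int[leb]_x (x ^+ 2 * phi x)%:E = 1)%E.
Proof.
rewrite ge0_symfun_integralT; last 3 first.
- by move=> x; rewrite mulr_ge0 ?sqr_ge0 ?normal_pdf_ge0.
- by move=> x; apply: cvgM; [exact: exprn_continuous|exact: continuous_phi].
- by move=> x /=; rewrite sqrrN phiN.
have dF x : is_derive x (1 : R) (fun x : R => Phi x - x * phi x) (x ^+ 2 * phi x).
  have := is_derive_Phi x; have := is_derive_phi x => ? ?.
  apply: is_derive_eq.
  by rewrite /GRing.scale/=; ring.
rewrite -set_itvcy (@ge0_continuous_FTC2y _ _ (fun x => Phi x - x * phi x) 0 1).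
- rewrite mul0r subr0 Phi0 -EFinB -EFinM; congr EFin; lra.
- by move=> x _; rewrite mulr_ge0 ?sqr_ge0 ?normal_pdf_ge0.
- apply: continuous_subspaceT => x.
  by apply: cvgM; [exact: exprn_continuous|exact: continuous_phi].
- by rewrite -[X in _ --> X]subr0; apply: cvgB; [exact: cvg_Phi_y|exact: cvg_id_phi_y].
- by move=> x _; have [] := dF x.
- apply: cvg_at_right_filter.
  by have [/derivable1_diffP/differentiable_continuous cF _] := dF 0; exact: cF.
- by move=> x _; rewrite derive1E; have := dF x => ?; rewrite derive_val.
Qed.

Lemma ge0_integralTN (f : R -> \bar R) : measurable_fun [set: R] f ->
  (forall x, (0 <= f x)%E) ->
  (\int[leb]_x f x = \int[leb]_x f (- x)%R)%E.
Proof.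
move=> mf f0.
rewrite -[in RHS](preimage_setT (-%R : measurableTypeR R -> measurableTypeR R)).
rewrite -[RHS](@ge0_integral_pushforward _ _ _ _ _
  (-%R : measurableTypeR R -> measurableTypeR R) _ leb setT f)//.
by apply: eq_measure_integral => //= A mA _; exact/esym/lebesgue_measureN.
Qed.

End standard_normal_moments.

(** * Random variables with a normal law *)

Section normal_variable.
Context d (T : measurableType d) {R : realType} (P : probability T R).
Notation leb := (@lebesgue_measure R).
Notation nprob m s := (normal_prob m s : probability (measurableTypeR R) R).
Notation phi := (normal_pdf (0 : R) 1).
Implicit Types (Y : {RV P >-> R}) (m s : R).

Lemma Lfun2_sqr_lty (f : T -> R) : measurable_fun [set: T] f ->
  (\int[P]_x (f x ^+ 2)%:E < +oo)%E -> f \in Lfun P 2%:E.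
Proof.
move=> mf f2; rewrite inE; apply/andP; split; rewrite inE//=.
rewrite /finite_norm unlock poweR_lty//.
rewrite (eq_integral (fun x => (f x ^+ 2)%:E))// => x _.
by rewrite /= powR_mulrn ?normr_ge0// real_normK ?num_real.
Qed.

(** One formula serves both cases of [has_normal_law]: for [s = 0] both sides are [f m], because
    [phi] has mass 1. *)
Lemma normal_law_expectation Y m s (f : R -> R) :
  0 <= s -> has_normal_law Y m s -> continuous f -> (forall x, 0 <= f x) ->
  (\int[P]_w (f (Y w))%:E = \int[leb]_x (f (m + s * x) * phi x)%:E)%E.
Proof.
move=> s0 Yms cf f0.
have mf : measurable_fun [set: R] (EFin \o f).
  by apply/measurable_EFinP; exact: continuous_measurable_fun.
(* [distribution P Y] and [normal_prob m s] live on copies of [R] with distinct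
   displays, so [Y] is recast before comparing the two measures. *)
have mY : measurable_fun [set: T] (Y : T -> measurableTypeR R).
  exact: (measurable_funP Y).
transitivity (\int[pushforward P (Y : T -> measurableTypeR R)]_y (f y)%:E)%E.
  by rewrite (ge0_integral_pushforward mY)// => y _; rewrite lee_fin.
move: s0; rewrite le_eqVlt => /predU1P[s0|s0]; last first.
  rewrite -integral_normal_std//.
  apply: eq_measure_integral => A mA _.
  by have := Yms A mA; rewrite gt_eqF.
transitivity (\int[\d_(m : measurableTypeR R)]_y (f y)%:E)%E.
  apply: eq_measure_integral => A mA _.
  by have := Yms A mA; rewrite -s0 eqxx.
rewrite integral_dirac//= diracT mul1e -s0.
under eq_integral do rewrite mul0r addr0 EFinM.
rewrite ge0_integralZl//.
- by rewrite integral_normal_pdf mule1.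
- by apply/measurable_EFinP; exact: measurable_normal_pdf.
- by move=> x _; rewrite lee_fin normal_pdf_ge0.
- by rewrite lee_fin.
Qed.

(** Centring at the parameter [m], before it is identified as the mean, gives square-integrability
    first; the mean can then be computed by subtraction. *)
Lemma normal_law_second_moment Y m s : 0 <= s -> has_normal_law Y m s ->
  (\int[P]_w ((Y w - m) ^+ 2)%:E = (s ^+ 2)%:E)%E.
Proof.
move=> s0 Yms.
rewrite (@normal_law_expectation Y m s (fun x => (x - m) ^+ 2))//; first last.
- by move=> x; exact: sqr_ge0.
- move=> x; apply: (@continuous_comp _ _ _ (fun x => x - m) (fun x => x ^+ 2)).
    by apply: cvgB => //; exact: cvg_cst.
  exact: exprn_continuous.
under eq_integral => x _ do rewrite addrC addKr exprMn -mulrA EFinM.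
rewrite ge0_integralZl//.
- by rewrite second_moment_phi mule1.
- apply/measurable_EFinP; apply: measurable_funM; last exact: measurable_normal_pdf.
  exact: measurable_funX.
- by move=> x _; rewrite lee_fin mulr_ge0 ?sqr_ge0 ?normal_pdf_ge0.
- by rewrite lee_fin sqr_ge0.
Qed.

Lemma normal_law_Lfun2 Y m s : 0 <= s -> has_normal_law Y m s ->
  (Y : T -> R) \in Lfun P 2%:E.
Proof.
move=> s0 Yms.
have -> : (Y : T -> R) = (fun w => Y w - m) + cst m.
  by apply/funext => w; rewrite /= addrfctE subrK.
rewrite rpredD//= ?lee1n ?Lfun_cst//.
move=> _; apply: Lfun2_sqr_lty; first exact: measurable_funB.
by rewrite (normal_law_second_moment s0 Yms) ltry.
Qed.

Lemma normal_law_Lfun1 Y m s : 0 <= s -> has_normal_law Y m s ->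
  (Y : T -> R) \in Lfun P 1.
Proof.
by move=> s0 Yms; apply: Lfun_subset12 (normal_law_Lfun2 s0 Yms);
  exact: fin_num_measure.
Qed.

(** By symmetry of [phi], the positive and negative parts of [Y - m] have equal integrals, and these
    are finite. *)
Lemma normal_law_mean Y m s : 0 <= s -> has_normal_law Y m s -> ('E_P[Y] = m%:E)%E.
Proof.
move=> s0 Yms.
have Y1 := normal_law_Lfun1 s0 Yms.
have Z1 : (Y \- cst m)%R \in Lfun P 1.
  by rewrite rpredB//= ?Lfun_cst.
(* Taking [g] to be the identity, then negation, yields the positive and the negative part. *)
have pn (g : R -> R) : continuous g -> 
    (\int[P]_w (Num.max (g (Y w - m)) 0)%:E =
    \int[leb]_x (Num.max (g (s * x)) 0 * phi x)%:E)%E.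
  move=> cg.
  rewrite (@normal_law_expectation Y m s (fun x => Num.max (g (x - m)) 0))//.
  - by apply: eq_integral => x _; rewrite addrC addKr.
  - move=> x; apply: continuous_max; last exact: cvg_cst.
    apply: continuous_comp; last exact: cg.
    by apply: cvgB => //; exact: cvg_cst.
  - by move=> x; rewrite le_max lexx orbT.
have E0 : ('E_P[(Y \- cst m)%R] = 0)%E.
  rewrite unlock integralE.
  have -> : (\int[P]_x ((fun w => ((Y \- cst m) w)%:E) ^\+ x)%E)%E =
    (\int[P]_x ((fun w => ((Y \- cst m) w)%:E) ^\- x)%E)%E.
    transitivity (\int[P]_w (Num.max (id (Y w - m)) 0)%:E)%E.
      by apply: eq_integral => x _; rewrite funeposE -EFin_max.
    rewrite (pn id); last by move=> x; exact: cvg_id.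
    rewrite ge0_integralTN; first last.
    - by move=> x; rewrite lee_fin mulr_ge0 ?normal_pdf_ge0// le_max lexx orbT.
    - apply/measurable_EFinP; apply: measurable_funM; last exact: measurable_normal_pdf.
      by apply: measurable_maxr => //; exact: measurable_funM.
    transitivity (\int[P]_w (Num.max (- (Y w - m)) 0)%:E)%E.
      rewrite (pn -%R); last exact: opp_continuous.
      by apply: eq_integral => x _; rewrite phiN mulrN.
    by apply: eq_integral => x _; rewrite funenegE -EFin_max.
  rewrite subee//; apply: integrable_neg_fin_num => //.
  exact/Lfun1_integrable.
move: E0; rewrite expectationB//; last exact: Lfun_cst.
rewrite expectation_cst => /eqP.
by rewrite sube_eq ?fin_num_adde_defl ?expectation_fin_num// add0e => /eqP.
Qed.

Lemma normal_law_variance Y m s : 0 <= s -> has_normal_law Y m s ->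
  ('V_P[Y] = (s ^+ 2)%:E)%E.
Proof.
move=> s0 Yms; rewrite /variance unlock (normal_law_mean s0 Yms)/=.
by rewrite unlock -(normal_law_second_moment s0 Yms).
Qed.

End normal_variable.

(** * Expected shortfall of normal laws *)

Section shortfall.
Context {R : realType}.
Notation leb := (@lebesgue_measure R).
Local Open Scope ereal_scope.

Lemma ereal_inf_affine (m s : R) (A : set R) : (0 < s)%R ->
  ereal_inf [set (m + s * x)%:E | x in A] =
  m%:E + s%:E * ereal_inf [set x%:E | x in A].
Proof.
move=> s0.
have le (n t : R) (B : set R) : (0 < t)%R ->
    n%:E + t%:E * ereal_inf [set x%:E | x in B] <=
    ereal_inf [set (n + t * x)%:E | x in B].
  move=> t0; apply: le_ereal_inf_tmp => _ [x Bx <-].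
  rewrite EFinD EFinM leeD2l// lee_pmul2l//.
  by apply: ereal_inf_lbound; exists x.
apply/eqP; rewrite eq_le le// andbT.
have si0 : (0 < s^-1)%R by rewrite invr_gt0.
(* The reverse inequality is the same bound for the inverse affine map, applied to the image of
   [A]. *)
have := le (- (s^-1 * m))%R s^-1%R [set (m + s * x)%R | x in A] si0.
rewrite !image_comp /=.
rewrite [X in _ <= ereal_inf X](_ : _ = [set x%:E | x in A]); last first.
  apply: eq_imagel => x Ax /=; congr EFin; field; exact: lt0r_neq0.
rewrite -(@lee_pmul2l _ s%:E)// -(@leeD2lE _ m%:E)//; apply: le_trans.
rewrite (_ : EFin \o _ = fun x => (m + s * x)%:E)//.
case: (ereal_inf [set (m + s * x)%:E | x in A]) => [r| |].
- by rewrite -!(EFinM, EFinD) lee_fin le_eqVlt; apply/orP; left; apply/eqP; field;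
    exact: lt0r_neq0.
- by rewrite !(gt0_muley, addey, addye)// ?lte_fin.
- by rewrite leNye.
Qed.

Lemma integral_cst_itv0 (p r : R) : (0 <= p)%R ->
  \int[leb]_(x in `[0%R, p]) r%:E = (r * p)%:E.
Proof.
move=> p0; rewrite integral_cst// EFinM; congr (_ * _).
rewrite [LHS]lebesgue_measure_itv/= lte_fin; case: ltP => [_|p0'].
  by rewrite sube0.
by congr EFin; apply/eqP; rewrite eq_le p0 p0'.
Qed.

(** Here [c] may be negative and [h] may have infinite integral. In that case the negative part of
    [c + h] is at most [|c|], while [h] is at most the positive part plus [|c|], so the positive
    part has infinite integral. *)
Lemma ge0_integral_addcst (p c : R) (h : R -> \bar R) : (0 <= p)%R ->
  measurable_fun `[0%R, p] h -> (forall x, `[0%R, p]%classic x -> 0 <= h x) ->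
  \int[leb]_(x in `[0%R, p]) (c%:E + h x) =
  (c * p)%:E + \int[leb]_(x in `[0%R, p]) h x.
Proof.
move=> p0 mh h0.
have icst r := integral_cst_itv0 r p0.
have [hfin|hoo] := ltP (\int[leb]_(x in `[0%R, p]) h x) +oo.
  rewrite integralD//.
  - by rewrite icst.
  - by apply/integrableP; split => //; rewrite (eq_integral (fun=> `|c|%:E))// icst ltry.
  - apply/integrableP; split => //.
    by under eq_integral => x /set_mem Dx do rewrite gee0_abs ?h0//.
move: hoo; rewrite leye_eq => /eqP hoo; rewrite hoo addey//.
set k := fun x => c%:E + h x.
have mk : measurable_fun `[0%R, p] k by exact: emeasurable_funD.
have kn : \int[leb]_(x in `[0%R, p]) k^\- x <= (`|c| * p)%:E.
  rewrite -icst; apply: ge0_le_integral => //.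
  - exact: measurable_funeneg.
  - move=> x Dx; rewrite funenegE ge_max lee_fin normr_ge0 andbT.
    rewrite leeNl /k; apply: (@le_trans _ _ c%:E).
      by rewrite -EFinN lee_fin lerNl -normrN ler_norm.
    by rewrite leeDl// h0.
have kp : \int[leb]_(x in `[0%R, p]) k^\+ x = +oo.
  apply/eqP; rewrite -leye_eq.
  have : +oo <= \int[leb]_(x in `[0%R, p]) (k^\+ x + `|c|%:E).
    rewrite -hoo; apply: ge0_le_integral => //.
    - by apply: emeasurable_funD => //; exact: measurable_funepos.
    - move=> x Dx; apply: (@le_trans _ _ (k x + `|c|%:E)).
        rewrite /k addeAC -EFinD leeDr// lee_fin -lerBlDr sub0r.
        by rewrite lerNl -normrN ler_norm.
      by rewrite leeD2r// funeposE le_max lexx.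
  rewrite ge0_integralD//; last exact: measurable_funepos.
  rewrite icst leye_eq => /eqP.
  by case: (\int[leb]_(x in `[0%R, p]) k^\+ x).
rewrite integralE kp.
have : 0 <= \int[leb]_(x in `[0%R, p]) k^\- x by exact: integral_ge0.
by move: kn; case: (\int[leb]_(x in `[0%R, p]) k^\- x) => // r.
Qed.

(* For [q <= 0] this is [-oo]. *)
Definition normal_quantile (q : R) : \bar R :=
  ereal_inf [set x%:E | x in [set x | (q < Phi x)%R]].

Lemma normal_quantile_nd : {homo normal_quantile : q r / (q <= r)%R >-> q <= r}.
Proof.
move=> q r qr; apply: ereal_inf_le_tmp => _ [x /= rx <-].
by exists x => //=; exact: le_lt_trans rx.
Qed.

(** By monotonicity, preimages of closed upper rays are intervals. *)
Lemma measurable_normal_quantile (D : set R) : measurable D ->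
  measurable_fun D (fun q => - normal_quantile q).
Proof.
move=> mD; apply: (measurability (@ErealGenCInfty.G R)).
  exact: ErealGenCInfty.measurableE.
move=> _ [_ [r ->] <-]; apply: measurableI => //.
apply: is_interval_measurable => s t /=.
rewrite !in_itv/= !andbT => rs rt u /andP[su ut].
rewrite in_itv/= andbT; apply: le_trans rt _.
by rewrite leeN2 normal_quantile_nd.
Qed.

(** As [Phi 0 = 2^-1] exceeds [p], continuity gives some [x < 0] with [p < Phi x]; then [v = - x]
    works for all [q <= p] at once. *)
Lemma normal_quantile_lt0 (p : R) : (p < 2^-1)%R ->
  exists2 v : R, (0 < v)%R & forall q, (q <= p)%R -> v%:E <= - normal_quantile q.
Proof.
move=> p2.
have cPhi : {for (0%R : R), continuous (@Phi R)}.
  have [/derivable1_diffP/differentiable_continuous cF _] := is_derive_Phi (0%R : R).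
  exact: cF.
near (0%R : R)^'- => x.
have px : (p < Phi x)%R.
  near: x; have /cvgr_gt := cvg_at_left_filter cPhi; apply.
  by rewrite Phi0.
have x0 : (x < 0)%R by near: x; exact: nbhs_left_lt.
exists (- x)%R; first by rewrite oppr_gt0.
move=> q qp; rewrite leeNr -EFinN opprK.
by apply: ereal_inf_lbound; exists x => //=; exact: le_lt_trans px.
Unshelve. all: by end_near. Qed.

Context d (T : measurableType d) (P : probability T R).
Implicit Types (Y : {RV P >-> R}) (m s p q : R).

Lemma cdf_normal_law Y m s x : (0 < s)%R -> has_normal_law Y m s ->
  cdf Y x = (Phi ((x - m) / s))%:E.
Proof.
move=> s0 Yms; rewrite -PhiE -normal_prob_Nyc_std//.
by rewrite /cdf Yms// gt_eqF.
Qed.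

Lemma VaR_normal_law Y m s q : (0 <= s)%R -> has_normal_law Y m s ->
  (0 <= q < 1)%R -> VaR q Y = (- m)%:E + s%:E * - normal_quantile q.
Proof.
move=> s0 Yms /andP[q0 q1]; rewrite /VaR.
move: s0; rewrite le_eqVlt => /predU1P[s0|s0].
  (* At [q = 0] the quantile is infinite, and the convention that zero times infinity is zero keeps
     the formula valid. *)
  rewrite -s0 mul0e adde0 EFinN; congr (- _).
  have cdfE x : cdf Y x = (m <= x)%R%:R%:E.
    by rewrite /cdf Yms// -s0 eqxx diracE/= mem_setE in_itv.
  apply/eqP; rewrite eq_le; apply/andP; split.
    apply: ereal_inf_lbound; exists m => //=.
    by rewrite cdfE lexx lte_fin.
  apply: le_ereal_inf_tmp => _ [x /= + <-].
  rewrite cdfE lte_fin lee_fin; case: (leP m x) => // _ /(le_lt_trans q0).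
  by rewrite ltxx.
rewrite muleN EFinN -oppeD; last by rewrite fin_num_adde_defr.
congr (- _); rewrite -ereal_inf_affine//; congr ereal_inf.
apply/seteqP; split => [_ [x /= qx <-]|_ [x /= qx <-]].
  exists ((x - m) / s)%R => /=.
    by move: qx; rewrite (cdf_normal_law _ s0 Yms) lte_fin.
  by congr EFin; field; exact: lt0r_neq0.
exists (m + s * x)%R => //=.
rewrite (cdf_normal_law _ s0 Yms) lte_fin (_ : (_ / s)%R = x)//.
by field; exact: lt0r_neq0.
Qed.

Definition normal_ES p : \bar R :=
  p^-1%:E * \int[leb]_(q in `[0%R, p]) - normal_quantile q.

(** The affine formula for [VaR] is integrated over [[0, p]]; [p < 2^-1] makes the quantile term
    nonnegative, so the integral splits without assuming [normal_ES p] finite. *)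
Lemma ES_normal_law Y m s p : (0 <= s)%R -> has_normal_law Y m s ->
  (0 < p < 2^-1)%R -> ES p Y = (- m)%:E + s%:E * normal_ES p.
Proof.
move=> s0 Yms /andP[p0 p2]; have [v v0 vq] := normal_quantile_lt0 p2.
have q0 q : `[0%R, p]%classic q -> 0 <= - normal_quantile q.
  rewrite /= in_itv/= => /andP[_ qp]; apply: le_trans (vq _ qp).
  by rewrite lee_fin ltW.
have mq : measurable_fun `[0%R, p] (fun q => - normal_quantile q).
  exact: measurable_normal_quantile.
have VE : \int[leb]_(q in `[0%R, p]) VaR q Y =
    \int[leb]_(q in `[0%R, p]) ((- m)%:E + s%:E * - normal_quantile q).
  apply: eq_integral => q /set_mem; rewrite /= in_itv/= => /andP[q0' qp].
  by rewrite (VaR_normal_law s0 Yms)// q0'/= (le_lt_trans qp)//; lra.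
rewrite /ES VE ge0_integral_addcst//; first last.
- by move=> q Dq; rewrite mule_ge0 ?lee_fin ?q0.
- exact: measurable_funeM.
- exact: ltW.
rewrite ge0_integralZl_EFin// /normal_ES muleCA.
rewrite muleDr ?fin_num_adde_defr// -?EFinM.
by congr (_%:E + _); rewrite mulrC mulfK// gt_eqF.
Qed.

Lemma normal_ES_gt0 p : (0 < p < 2^-1)%R -> 0 < normal_ES p.
Proof.
move=> /andP[p0 p2]; have [v v0 vq] := normal_quantile_lt0 p2.
apply: (@lt_le_trans _ _ (p^-1 * (v * p))%:E).
  by rewrite lte_fin !mulr_gt0// invr_gt0.
rewrite EFinM lee_pmul2l//; last by rewrite lte_fin invr_gt0.
apply: (@le_trans _ _ (\int[leb]_(q in `[0%R, p]) v%:E)).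
  by rewrite integral_cst_itv0// ltW.
apply: ge0_le_integral => //.
- by move=> q _; rewrite lee_fin ltW.
- exact: measurable_normal_quantile.
- by move=> q; rewrite /= in_itv/= => /andP[_ qp]; exact: vq.
Qed.

End shortfall.

(** * Laws of portfolio payoffs *)

Section payoffs.
Context d (T : measurableType d) {R : realType} (P : probability T R).
Implicit Types (Y : {RV P >-> R}) (m s : R).
Local Open Scope ereal_scope.

Lemma normal_law_gt0 Y m s : (0 <= s)%R -> has_normal_law Y m s ->
  (0 < m)%R -> 0 < P [set w | (0 < Y w)%R].
Proof.
move=> s0 Yms m0.
have setE : [set w | (0 < Y w)%R] = Y @^-1` `]0%R, +oo[.
  by apply/seteqP; split => w /=; rewrite in_itv/= andbT.
move: s0; rewrite le_eqVlt => /predU1P[s0|s0].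
  have := Yms `]0%R, +oo[%classic (measurable_itv _).
  rewrite -s0 eqxx /distribution /pushforward setE => ->.
  by rewrite diracE mem_set ?lte01//= in_itv/= m0.
have setCE : Y @^-1` `]0%R, +oo[ = ~` (Y @^-1` `]-oo, 0%R]).
  by rewrite preimage_setC setCitvl.
rewrite setE setCE probability_setC; last first.
  by rewrite -[X in measurable X]setTI; exact: measurable_funP.
(* The mass of []-oo, 0]] is at most that of []-oo, m]], which is [Phi 0 = 2^-1]. *)
rewrite sube_gt0; apply: (@le_lt_trans _ _ (cdf Y m)).
  by rewrite -[leLHS]/(cdf Y 0%R) cdf_nondecreasing// ltW.
rewrite (cdf_normal_law m s0 Yms) subrr mul0r Phi0 lte_fin; lra.
Qed.

Lemma degenerate_law_gt0 Y m : has_normal_law Y m 0 ->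
  0 < P [set w | (0 < Y w)%R] -> (0 < m)%R.
Proof.
move=> Ym.
have setE : [set w | (0 < Y w)%R] = Y @^-1` `]0%R, +oo[.
  by apply/seteqP; split => w /=; rewrite in_itv/= andbT.
have := Ym `]0%R, +oo[%classic (measurable_itv _).
rewrite eqxx /distribution /pushforward setE => ->.
by rewrite diracE mem_setE in_itv/= andbT; case: (0 < m)%R; rewrite ?ltxx.
Qed.

Lemma has_normal_law_ae Y Y' m s : {ae P, forall w, Y w = Y' w} ->
  has_normal_law Y' m s -> has_normal_law Y m s.
Proof.
move=> YY' Y'ms A mA; rewrite -Y'ms//.
have mpre (Z : {RV P >-> R}) : measurable (Z @^-1` A).
  by rewrite -[X in measurable X]setTI; exact: measurable_funP.
have dE (Z : {RV P >-> R}) :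
    distribution P Z A = \int[P]_w (\1_(Z @^-1` A) w)%:E.
  by rewrite /distribution /pushforward integral_indic ?setIT.
rewrite !dE; apply: ae_eq_integral => //.
- by apply/measurable_EFinP; exact: measurable_indic.
- by apply/measurable_EFinP; exact: measurable_indic.
apply: filterS YY' => w Yw _; rewrite !indicE; congr ((nat_of_bool _)%:R%:E).
by apply/idP/idP; rewrite !inE /preimage/= Yw.
Qed.

Lemma expectation_suml (I : Type) (r : seq I) (f : I -> T -> R) :
  (forall i, f i \in Lfun P 1) ->
  'E_P[\sum_(i <- r) f i] = \sum_(i <- r) 'E_P[f i].
Proof.
move=> f1; elim: r => [|i r IH]; first by rewrite !big_nil expectation_cst.
by rewrite !big_cons expectationD ?IH// rpred_sum.
Qed.

Lemma covariance_suml (I : Type) (r : seq I) (f : I -> T -> R) (g : T -> R) :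
  (forall i, f i \in Lfun P 2%:E) -> g \in Lfun P 2%:E ->
  covariance P (\sum_(i <- r) f i)%R g = \sum_(i <- r) covariance P (f i) g.
Proof.
move=> f2 g2; elim: r => [|i r IH]; first by rewrite !big_nil covariance_cst_l.
by rewrite !big_cons covarianceDl ?IH// rpred_sum// lee1n.
Qed.

Context (N : nat) (X : 'I_N -> {RV P >-> R}) (mu : 'cV[R]_N) (Sigma : 'M[R]_N).
Hypothesis hX : multivariate_normal X mu Sigma.
Implicit Types a b : 'cV[R]_N.

Lemma payoff_sum a : payoff X a = (\sum_(j < N) a j 0%R \o* X j)%R :> (T -> R).
Proof.
apply/funext => w; rewrite payoffE fct_sumE.
by apply: eq_bigr => j _; rewrite /= mulrC.
Qed.

(** Normality is assumed of portfolios; seen as a unit portfolio, each asset inherits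
    square-integrability. *)
Lemma payoff_delta j : payoff X (delta_mx j 0)%R = X j :> (T -> R).
Proof.
apply/funext => w; rewrite payoffE (bigD1 j)//= mxE !eqxx mul1r big1 ?addr0//.
by move=> i ij; rewrite mxE (negbTE ij) mul0r.
Qed.

Lemma payoff_Lfun2 a : (payoff X a : T -> R) \in Lfun P 2%:E.
Proof.
have [+ _ _] := hX => /(_ a) [m [s [s0 ams]]].
exact: normal_law_Lfun2 ams.
Qed.

Lemma asset_Lfun2 j : (X j : T -> R) \in Lfun P 2%:E.
Proof. by rewrite -payoff_delta; exact: payoff_Lfun2. Qed.

Lemma Lfun2_Lfun1 (f : T -> R) : f \in Lfun P 2%:E -> f \in Lfun P 1.
Proof. by apply: Lfun_subset12; exact: fin_num_measure. Qed.

Lemma expectation_payoff a : 'E_P[payoff X a] = (dot mu a)%:E.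
Proof.
have [_ EX _] := hX.
rewrite payoff_sum expectation_suml; last first.
  by move=> j; apply: Lfun2_Lfun1; rewrite Lfun_scale ?asset_Lfun2// ler1n.
rewrite /dot mxE -sumEFin; apply: eq_bigr => j _.
by rewrite expectationZl ?EX ?mxE -?EFinM 1?mulrC// Lfun2_Lfun1 ?asset_Lfun2.
Qed.

Lemma covariance_payoff a b :
  covariance P (payoff X a) (payoff X b) = ((a^T *m Sigma *m b) 0 0)%R%:E.
Proof.
have [_ _ CX] := hX.
have X2 := asset_Lfun2.
have pcov j : covariance P (X j) (payoff X b) = ((Sigma *m b) j 0)%R%:E.
  rewrite covarianceC payoff_sum covariance_suml; last 2 first.
  - by move=> i; rewrite Lfun_scale// ler1n.
  - exact: X2.
  rewrite mxE -sumEFin; apply: eq_bigr => i _.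
  rewrite covarianceZl ?Lfun2_mul_Lfun1 ?Lfun2_Lfun1//.
  by rewrite covarianceC CX -EFinM mulrC.
rewrite [X in covariance P X]payoff_sum covariance_suml; last 2 first.
- by move=> i; rewrite Lfun_scale// ler1n.
- exact: payoff_Lfun2.
rewrite -mulmxA mxE -sumEFin; apply: eq_bigr => j _.
rewrite covarianceZl ?Lfun2_mul_Lfun1 ?Lfun2_Lfun1 ?payoff_Lfun2//.
by rewrite pcov -EFinM [a^T _ _]mxE.
Qed.

Lemma portfolio_variance_ge0 a : (0 <= portfolio_variance Sigma a)%R.
Proof. by rewrite -lee_fin -covariance_payoff variance_ge0. Qed.

(** Joint normality provides some parameters [m] and [s]; computing mean and variance in two ways
    identifies them. *)
Lemma payoff_law a :
  has_normal_law (payoff X a) (dot mu a) (Num.sqrt (portfolio_variance Sigma a)).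
Proof.
have [+ _ _] := hX => /(_ a) [m [s [s0 ams]]].
have := normal_law_mean s0 ams; rewrite expectation_payoff => -[->].
have := normal_law_variance s0 ams; rewrite /variance covariance_payoff => -[].
by rewrite -/(portfolio_variance Sigma a) => ->; rewrite sqrtr_sqr ger0_norm.
Qed.

Lemma portfolio_cov_le a b : ((a^T *m Sigma *m b) 0 0 <=
  Num.sqrt (portfolio_variance Sigma a) * Num.sqrt (portfolio_variance Sigma b))%R.
Proof.
have := covariance_le (payoff_Lfun2 a) (payoff_Lfun2 b).
by rewrite /variance !covariance_payoff.
Qed.

Lemma covariance_sym : Sigma^T = Sigma.
Proof.
have [_ _ CX] := hX; apply/matrixP => i j; rewrite mxE.
by apply: EFin_inj; rewrite -!CX covarianceC.
Qed.

End payoffs.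

(** * Portfolios and the kernel of the covariance matrix *)

Section linear_algebra.
Context {R : realType} (N : nat).
Implicit Types a b c u : 'cV[R]_N.

Lemma dotDr u a b : dot u (a + b) = dot u a + dot u b.
Proof. by rewrite /dot mulmxDr mxE. Qed.

Lemma dotZr u t a : dot u (t *: a) = t * dot u a.
Proof. by rewrite /dot -scalemxAr mxE. Qed.

Lemma dotBl u v a : dot (u - v) a = dot u a - dot v a.
Proof. by rewrite /dot linearB /= mulmxBl !mxE. Qed.

Lemma dotZl t u a : dot (t *: u) a = t * dot u a.
Proof. by rewrite /dot linearZ /= -scalemxAl mxE. Qed.

Lemma portfolio_variance_kerD (Sigma : 'M[R]_N) k a t :
  Sigma^T = Sigma -> Sigma *m k = 0 ->
  portfolio_variance Sigma (a + t *: k) = portfolio_variance Sigma a.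
Proof.
move=> SigmaT k0.
have kT0 : k^T *m Sigma = 0 by rewrite -[Sigma]SigmaT -trmx_mul k0 trmx0.
have trD : (a + t *: k)^T = a^T + t *: k^T by apply/matrixP => i j; rewrite !mxE.
rewrite /portfolio_variance trD.
rewrite mulmxDl -scalemxAl kT0 scaler0 addr0.
by rewrite mulmxDr -scalemxAr -[_ *m k]mulmxA k0 mulmx0 scaler0 addr0.
Qed.

(** The kernel is the line through [k], so every column of [cokermx Sigma] is a multiple of [k] and
    is annihilated by [e^T]. Hence [e^T] lies in the row space, which by symmetry is the image. *)
Lemma orth_ker_im (Sigma : 'M[R]_N) k e :
  Sigma^T = Sigma -> \rank (kermx Sigma^T) = 1%N ->
  k != 0 -> Sigma *m k = 0 -> dot e k = 0 -> exists b, e = Sigma *m b.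
Proof.
move=> SigmaT rk k0 Sk ek.
have kker : (k^T <= kermx Sigma^T)%MS.
  by apply/sub_kermxP; rewrite -trmx_mul Sk trmx0.
have kerk : (kermx Sigma^T <= k^T)%MS.
  by rewrite -(mxrank_leqif_sup kker).2 rk rank_rV trmx_eq0 k0.
have /submxP[D De] : ((cokermx Sigma)^T <= k^T)%MS.
  apply: submx_trans kerk; apply/sub_kermxP.
  by rewrite -trmx_mul mulmx_coker trmx0.
have : (e^T <= Sigma)%MS.
  rewrite submxE -[cokermx Sigma]trmxK De trmx_mul trmxK mulmxA.
  suff -> : e^T *m k = 0 by rewrite mul0mx.
  by apply/matrixP => i j; rewrite !ord1 [RHS]mxE; exact: ek.
case/submxP => w we; exists w^T.
by rewrite -[e]trmxK we trmx_mul SigmaT.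
Qed.

End linear_algebra.

(** * Arbitrage *)

Lemma payoff_ES_arbitrage (R : realType) (d : measure_display)
    (T : measurableType d) (P : probability T R) (N : nat)
    (X : 'I_N -> {RV P >-> R}) (mu : 'cV[R]_N) (Sigma : 'M[R]_N) (c a : 'cV[R]_N) p :
  multivariate_normal X mu Sigma -> 0 < p < 2^-1 ->
  dot c a <= 0 -> 0 < dot mu a ->
  ((Num.sqrt (portfolio_variance Sigma a))%:E * normal_ES p <= (dot mu a)%:E)%E ->
  admits_ES_arbitrage (markowitz_price X c) p.
Proof.
move=> hX p02 ca mua ESa; exists (payoff X a).
have law := payoff_law hX a; have s0 := sqrtr_ge0 (portfolio_variance Sigma a).
split.
- apply: (@le_trans _ _ (dot c a)%:E); last by rewrite lee_fin.
  apply: ereal_inf_lbound; exists a => //=.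
  exact: aeW.
- rewrite (ES_normal_law s0 law)// EFinN addeC.
  by rewrite leeBlDr// add0e.
- exact: normal_law_gt0 s0 law mua.
Qed.

Theorem theorem2p1 (R : realType)
  (d : measure_display) (T : measurableType d) (P : probability T R)
  (N : nat) (hN : (2 <= N)%N)
  (X : 'I_N -> {RV P >-> R}) (mu : 'cV[R]_N) (Sigma : 'M[R]_N)
  (hX : multivariate_normal X mu Sigma)
  (c : 'cV[R]_N)
  (* the kernel of Sigma is one-dimensional ([kermx] is the row kernel) *)
  (hker : \rank (kermx Sigma^T) = 1%N)
  (aF : 'cV[R]_N) (haF : Sigma *m aF = 0) (hcF : dot c aF = 1)
  (RF : R) (hRF : 1 + RF = dot mu aF)
  (d' : measure_display) (T' : measurableType d') (P' : probability T' R)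
  (Z : {RV P' >-> R}) (hZ : standard_normal Z)
  (p : R) (hp0 : 0 < p) (hp1 : p < 2^-1) :
  admits_ES_arbitrage (markowitz_price X c) p <->
  (ES p Z <= capital_allocation_gradient c mu Sigma RF)%E \/ 1 + RF < 0.
Proof.
have p02 : 0 < p < 2^-1 by rewrite hp0.
have ESZ : ES p Z = normal_ES p.
  by rewrite (ES_normal_law ler01 hZ)// oppr0 add0e mul1e.
have ES0 := normal_ES_gt0 p02; rewrite ESZ.
have SigmaT := covariance_sym hX.
have aF0 : aF != 0.
  apply/eqP => aF0; move: hcF; rewrite aF0 /dot mulmx0 mxE => /eqP.
  by rewrite eq_sym oner_eq0.
pose e := mu - (1 + RF) *: c.
have eE a : dot e a = dot mu a - (1 + RF) * dot c a by rewrite dotBl dotZl.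
have [b eb] : exists b, e = Sigma *m b.
  by apply: orth_ker_im hker aF0 haF _ => //; rewrite eE hcF mulr1 hRF subrr.
have eb_cov a : dot e a = (b^T *m Sigma *m a) 0 0.
  by rewrite /dot eb trmx_mul SigmaT.
have dot_le a : dot e a <=
    Num.sqrt (portfolio_variance Sigma b) * Num.sqrt (portfolio_variance Sigma a).
  by rewrite eb_cov; exact: (portfolio_cov_le hX).
split.
- move=> [Y [priceY ESY Y0]]; have [RF0|RF0] := ltP (1 + RF) 0; [by right|left].
  (* The price is an infimum over portfolios, so a nonpositive price gives one of cost below each
     positive [eps]. *)
  have rep eps : 0 < eps ->
      exists2 a, {ae P, forall w, Y w = payoff X a w} & dot c a < eps.
    move=> eps0; have : (markowitz_price X c Y < eps%:E)%E.
      by apply: le_lt_trans priceY _; rewrite lte_fin.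
    by move=> /ereal_inf_lt[_ [a Ya <-]]; rewrite lte_fin => ca; exists a.
  have [a0 Ya0 _] := rep 1 ltr01.
  set m := dot mu a0; set v := portfolio_variance Sigma a0.
  have Ylaw a : {ae P, forall w, Y w = payoff X a w} ->
      has_normal_law Y (dot mu a) (Num.sqrt (portfolio_variance Sigma a)).
    by move=> Ya; exact: has_normal_law_ae Ya (payoff_law hX a).
  have v_ge0 a := portfolio_variance_ge0 hX a.
  have same a : {ae P, forall w, Y w = payoff X a w} ->
      dot mu a = m /\ portfolio_variance Sigma a = v.
    move=> Ya; split; apply: EFin_inj.
      by rewrite -(normal_law_mean (sqrtr_ge0 _) (Ylaw _ Ya))
        -(normal_law_mean (sqrtr_ge0 _) (Ylaw _ Ya0)).
    rewrite -[LHS]/(portfolio_variance Sigma a)%:E -(sqr_sqrtr (v_ge0 a)).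
    rewrite -(normal_law_variance (sqrtr_ge0 _) (Ylaw _ Ya)).
    by rewrite (normal_law_variance (sqrtr_ge0 _) (Ylaw _ Ya0)) sqr_sqrtr.
  have Y_law : has_normal_law Y m (Num.sqrt v) by exact: Ylaw.
  have := ESY; rewrite (ES_normal_law (sqrtr_ge0 v) Y_law p02) EFinN addeC.
  rewrite leeBlDr// add0e => ESm.
  have [v0|v0] := ltP 0 v; last first.
    have sv0 : Num.sqrt v = 0 by exact: ler0_sqrtr.
    have m0 : 0 < m by rewrite sv0 in Y_law; exact: degenerate_law_gt0 Y_law Y0.
    (* Cauchy-Schwarz against [b] and against [- b] forces [dot e a = 0] when the variance is
       zero. *)
    have ca a : {ae P, forall w, Y w = payoff X a w} -> m = (1 + RF) * dot c a.
      move=> Ya; have [ma va] := same _ Ya.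
      have le1 : dot e a <= 0 by have := dot_le a; rewrite va sv0 mulr0.
      have le2 : - dot e a <= 0.
        have := portfolio_cov_le hX (- b) a.
        rewrite -/(portfolio_variance Sigma a) va sv0 mulr0; apply: le_trans.
        by rewrite eb_cov [(- b)^T]linearN !mulNmx [leRHS]mxE.
      by move: le1 le2; rewrite eE ma; lra.
    have RF1 : 0 < 1 + RF.
      rewrite lt_neqAle RF0 andbT; apply/eqP => RF1.
      by move: m0; rewrite (ca _ Ya0) -RF1 mul0r ltxx.
    (* Every representing portfolio costs exactly [m / (1 + RF)], so none can cost less. *)
    have [a Ya] := rep (m / (1 + RF)) (divr_gt0 m0 RF1).
    by rewrite (ca _ Ya) mulrC mulKf ?ltxx// gt_eqF.
  have sv0 : 0 < Num.sqrt v by rewrite sqrtr_gt0.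
  (* An infinite shortfall times the positive deviation could not be bounded by [m]. *)
  have [E ESE] : exists E, normal_ES p = E%:E.
    move: ESm ES0; case: (normal_ES p) => [E| |]; [by exists E| |by []].
    by rewrite gt0_muley// lte_fin.
  rewrite ESE in ESm *; rewrite -EFinM lee_fin in ESm.
  apply/lee_addgt0Pr => eps eps0.
  (* This cost bound times [1 + RF] is at most [eps * Num.sqrt v]; the extra 1 keeps the denominator
     positive when [1 + RF = 0]. *)
  have eps'0 : 0 < eps * Num.sqrt v / (1 + (1 + RF)).
    by rewrite divr_gt0 ?mulr_gt0// ltr_pwDl.
  have [a Ya ca] := rep _ eps'0; have [ma va] := same _ Ya.
  (* Adding [aF] leaves the variance unchanged, and the excess mean of [a1] is
     [m - (1 + RF) * dot c a]. *)
  pose a1 := a + (1 - dot c a) *: aF.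
  rewrite -leeBlDr//.
  apply: (@le_trans _ _
      ((dot mu a1 - (1 + RF)) / Num.sqrt (portfolio_variance Sigma a1))%:E);
    last first.
    apply: ereal_sup_ubound; exists a1 => //=; split.
      by rewrite dotDr dotZr hcF mulr1 addrC subrK.
    by rewrite portfolio_variance_kerD// va.
  rewrite portfolio_variance_kerD// va dotDr dotZr -hRF ma -EFinB lee_fin.
  rewrite ler_pdivlMr//.
  have : (1 + RF) * dot c a <= eps * Num.sqrt v.
    apply: le_trans (ler_wpM2l RF0 (ltW ca)) _.
    rewrite mulrA ler_pdivrMr ?ltr_pwDl// mulrC ler_wpM2l ?mulr_ge0 ?ltW//.
    by rewrite ltrDr.
  lra.
- move=> [ESg|RF0]; last first.
    apply: (payoff_ES_arbitrage (a := - aF) hX p02).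
    + by rewrite -scaleN1r dotZr hcF; lra.
    + by rewrite -scaleN1r dotZr -hRF; lra.
    + rewrite -[- aF]add0r -scaleN1r portfolio_variance_kerD//.
      (* Zero deviation removes the shortfall term, whether or not [normal_ES p] is finite. *)
      rewrite /portfolio_variance mulmx0 mxE sqrtr0 mul0e add0r dotZr -hRF.
      by rewrite lee_fin; lra.
  have gle : (capital_allocation_gradient c mu Sigma RF <=
      (Num.sqrt (portfolio_variance Sigma b))%:E)%E.
    apply: ge_ereal_sup => _ [a /= [ca va] <-].
    rewrite lee_fin ler_pdivrMr ?sqrtr_gt0//.
    by apply: le_trans (dot_le a); rewrite eE ca mulr1.
  have ESb := le_trans ESg gle.
  have vb : 0 < Num.sqrt (portfolio_variance Sigma b).
    by rewrite -lte_fin; exact: lt_le_trans ES0 ESb.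
  (* With deviation [sigma] and mean [sigma ^+ 2], the shortfall condition
     [sigma * E(p) <= sigma ^+ 2] reduces to [ESb]. *)
  have vbE : portfolio_variance Sigma (b + - dot c b *: aF) = portfolio_variance Sigma b.
    by rewrite portfolio_variance_kerD.
  have cb : dot c (b + - dot c b *: aF) = 0.
    by rewrite dotDr dotZr hcF mulr1 subrr.
  have mb : dot mu (b + - dot c b *: aF) = Num.sqrt (portfolio_variance Sigma b) ^+ 2.
    rewrite sqr_sqrtr ?(portfolio_variance_ge0 hX)//.
    rewrite dotDr dotZr -hRF /portfolio_variance -eb_cov eE; ring.
  apply: (payoff_ES_arbitrage (a := b + - dot c b *: aF) hX p02).
  + by rewrite cb.
  + by rewrite mb exprn_gt0.
  + by rewrite mb vbE expr2 EFinM lee_pmul2l// lte_fin.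
Qed.
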